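(* Consider a power distribution network on a directed rooted tree with node set $\{0,1,\dots,n\}$, $n\ge 1$, with one slack bus (node $0$) and $n$ PQ buses (nodes $1,\dots,n$), described by the relaxed branch flow model, with power flow Jacobian $\varphi_u$ and reduced power flow Jacobian $\varphi_u'$ (both defined in the context, as functions of the grid variables $\overline p,\overline q,\ell\in\mathbb{R}^n$ and $v\in\mathbb{R}^{n+1}$). The following statements hold. (i) $\det(\varphi_u)=\det(\varphi_u')$. (ii) $\det(\varphi_u')>0$ in the voltage stability region. (iii) $\det(\varphi_u')=0$ if and only if there exists $i\in\delta(0)$ such that $\det(\varphi_{u,i}')=0$, where $\varphi_{u,i}'$ is the reduced power flow Jacobian of the tree composed of node $0$ and the subtree rooted at the child $i$ of node $0$ (with the edge from $0$ to $i$), evaluated at the restriction of the grid variables to this tree. Here (i) and (iii) are identities/equivalences between functions of the grid variables, holding at all values of $(\overline p,\overline q,\ell,v)$.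
   Context: **Network.** $G=(N,E)$ is a directed tree with $N=\{0,1,\dots,n\}$ and root $0$; $(i,j)\in E$ means that $i$ is the parent of $j$. $\delta(i)$ is the set of children of $i$, and $\pi(j)$ is the unique parent of $j\neq 0$. Thus $|E|=n$. Each edge $(\pi(j),j)$ is indexed by its child node $j\in\{1,\dots,n\}$, and vectors indexed by $E$ are ordered accordingly. **Variables and parameters.** Each edge $(i,j)$ has impedance $r_{ij}+\mathbf{j}x_{ij}$ (real numbers $r_{ij},x_{ij}$), squared current magnitude $\ell_{ij}$, and sending-end active and reactive powers $p_{ij},q_{ij}$. Each node $i$ has squared voltage magnitude $v_i$ and active and reactive power demands $p_i,q_i$. Being squared magnitudes, $v_i$ and $\ell_{ij}$ are nonnegative at operating points. Stack these into $\overline p,\overline q,\ell,r,x\in\mathbb{R}^n$ (edge vectors) and $p,q,v\in\mathbb{R}^{n+1}$ (node vectors). For a vector $y$, $[y]$ is the diagonal matrix with diagonal $y$. $\mathbf{0}$ and $\mathbf{1}$ are the all-zeros and all-ones vectors/matrices. **Matrices.** $A^i,A^o\in\{0,1\}^{(n+1)\times n}$, with rows indexed by nodes and columns by edges: the row of $A^i$ corresponding to node $j$ has a $1$ exactly at the edge $(\pi(j),j)$ (row $0$ is zero); the row of $A^o$ corresponding to node $i$ has a $1$ exactly at the edges $(i,k)$ with $k\in\delta(i)$. $A:=A^o-A^i$. $A_2$ and $A_2^o$ are the $n\times n$ matrices obtained from $A$ and $A^o$ by removing the first row (that of node $0$). $\mathbf e_1$ is the first canonical basis vector of $\mathbb{R}^{n+1}$.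 **Relaxed branch flow model.** Let $u=(\overline p,\overline q,\ell,v_{1\ldots n},p_0,q_0)\in\mathbb{R}^{4n+2}$ (variables) and $\xi=(v_0,p_{1\ldots n},q_{1\ldots n})\in\mathbb{R}^{2n+1}$ (parameters). The model is $\varphi(u,\xi)=\mathbf 0$, where $\varphi$ has the four blocks $$-A\overline p-A^i[r]\ell-p,\qquad -A\overline q-A^i[x]\ell-q,$$ $$A^Tv-2([r]\overline p+[x]\overline q)+([r]^2+[x]^2)\ell,\qquad [\overline p]\overline p+[\overline q]\overline q-[A^{oT}v]\ell .$$ Node $0$ is a slack bus, with $v_0=1$ imposed. **Power flow Jacobian.** $\varphi_u=\partial\varphi/\partial u$, i.e. the $(4n+2)\times(4n+2)$ matrix $$\varphi_u=\begin{bmatrix}-A&\mathbf 0&-A^i[r]&\mathbf 0&-\mathbf e_1&\mathbf 0\\ \mathbf 0&-A&-A^i[x]&\mathbf 0&\mathbf 0&-\mathbf e_1\\ -2[r]&-2[x]&[r]^2+[x]^2&A_2^T&\mathbf 0&\mathbf 0\\ 2[\overline p]&2[\overline q]&-[A^{oT}v]&-[\ell]A_2^{oT}&\mathbf 0&\mathbf 0\end{bmatrix}.$$ **Reduced power flow Jacobian.** The $n\times n$ matrix $$\varphi_u'=[A^{oT}v]+2[\overline p]A_2^{-1}[r]+2[\overline q]A_2^{-1}[x]-[\ell]A_2^{oT}(A_2^T)^{-1}\big([r]^2+2[r]A_2^{-1}[r]+[x]^2+2[x]A_2^{-1}[x]\big).$$ For a subtree containing node $0$ as root, its reduced power flow Jacobian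 is defined by the same formula with the matrices $A^o,A_2,A_2^o$ of that subtree and the restrictions of $r,x,\overline p,\overline q,\ell,v$ to it. **Voltage stability region.** The flat voltage solution is the solution of $\varphi(u,\xi)=\mathbf 0$ with $v=\mathbf 1$ and $p=q=\mathbf 0$, $\overline p=\overline q=\ell=\mathbf 0$. The voltage stability region is the open region (relative to the set of power flow solutions) surrounding the flat voltage solution on which $\det(\varphi_u)\ne0$; that is, the connected component containing the flat voltage solution of the set of all $(u,\xi)$ with $\varphi(u,\xi)=\mathbf 0$, $v_0=1$, $v\ge \mathbf 0$, $\ell\ge \mathbf 0$ and $\det(\varphi_u)\neq0$. *)

(* Defs.v *)
From HB Require Import structures.
From mathcomp Require Import all_boot all_order all_algebra.
From mathcomp Require Import all_classical all_reals all_analysis zify ring.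

Set Implicit Arguments.
Unset Strict Implicit.
Unset Printing Implicit Defensive.

Import Order.TTheory GRing.Theory Num.Theory.
Import numFieldNormedType.Exports.

Local Open Scope classical_set_scope.
Local Open Scope ring_scope.

(* Nodes are 'I_n.+1 with root [ord0]; [E i j] means that i is the parent of j.
   An edge is identified with its child node, so edges are 'I_n and the edge
   e : 'I_n ends at the node [child e]. *)
Definition child n (e : 'I_n) : 'I_n.+1 := lift ord0 e.

Definition rooted_tree n (E : rel 'I_n.+1) : Prop :=
  [/\ forall i, ~~ E i ord0,
      forall j, j != ord0 -> exists! i, E i j
    & forall j, connect E ord0 j].

Section Matrices.
Variables (R : fieldType) (n : nat) (E : rel 'I_n.+1).

Definition dg k (y : 'cV[R]_k) : 'M[R]_k := diag_mx y^T.

Definition Ai : 'M[R]_(1 + n, n) := \matrix_(j, e) (j == child e)%:R.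
Definition Ao : 'M[R]_(1 + n, n) := \matrix_(i, e) (E i (child e))%:R.
Definition A : 'M[R]_(1 + n, n) := Ao - Ai.
Definition A2 : 'M[R]_n := dsubmx A.
Definition A2o : 'M[R]_n := dsubmx Ao.
Definition e1 : 'cV[R]_(1 + n) := delta_mx ord0 0.

(* u = (pb, qb, l, v_{1..n}, p_0, q_0) and xi = (v_0, p_{1..n}, q_{1..n}). *)
Definition udim := (n + (n + (n + (n + (1 + 1)))))%N.
Definition xidim := (1 + (n + n))%N.
Definition eqdim := ((1 + n) + ((1 + n) + (n + n)))%N.

Definition mk_u (pb qb l v' : 'cV[R]_n) (p0 q0 : 'cV[R]_1) : 'cV[R]_udim :=
  col_mx pb (col_mx qb (col_mx l (col_mx v' (col_mx p0 q0)))).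
Definition mk_xi (v0 : 'cV[R]_1) (p' q' : 'cV[R]_n) : 'cV[R]_xidim :=
  col_mx v0 (col_mx p' q').

Implicit Types (u h : 'cV[R]_udim) (xi : 'cV[R]_xidim).

Definition pb_of u : 'cV[R]_n := usubmx u.
Definition qb_of u : 'cV[R]_n := usubmx (dsubmx u).
Definition l_of u : 'cV[R]_n := usubmx (dsubmx (dsubmx u)).
Definition v_of u xi : 'cV[R]_(1 + n) :=
  col_mx (usubmx xi) (usubmx (dsubmx (dsubmx (dsubmx u)))).
Definition p_of u xi : 'cV[R]_(1 + n) :=
  col_mx (usubmx (dsubmx (dsubmx (dsubmx (dsubmx u))))) (usubmx (dsubmx xi)).
Definition q_of u xi : 'cV[R]_(1 + n) :=
  col_mx (dsubmx (dsubmx (dsubmx (dsubmx (dsubmx u))))) (dsubmx (dsubmx xi)).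

Variables r x : 'cV[R]_n.

Definition phi u xi : 'cV[R]_eqdim :=
  let pb := pb_of u in let qb := qb_of u in let l := l_of u in
  let v := v_of u xi in let p := p_of u xi in let q := q_of u xi in
  col_mx (- (A *m pb) - Ai *m dg r *m l - p)
 (col_mx (- (A *m qb) - Ai *m dg x *m l - q)
 (col_mx (A^T *m v - 2%:R *: (dg r *m pb + dg x *m qb)
            + (dg r *m dg r + dg x *m dg x) *m l)
         (dg pb *m pb + dg qb *m qb - dg (Ao^T *m v) *m l))).

Definition phi_u_blocks (pb qb l : 'cV[R]_n) (v : 'cV[R]_(1 + n)) :
    'M[R]_(eqdim, udim) :=
  col_mx
    (row_mx (- A) (row_mx 0 (row_mx (- (Ai *m dg r)) (row_mx 0
      (row_mx (- e1) 0)))))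
 (col_mx
    (row_mx 0 (row_mx (- A) (row_mx (- (Ai *m dg x)) (row_mx 0
      (row_mx 0 (- e1))))))
 (col_mx
    (row_mx (- 2%:R *: dg r) (row_mx (- 2%:R *: dg x)
      (row_mx (dg r *m dg r + dg x *m dg x) (row_mx A2^T (row_mx 0 0)))))
    (row_mx (2%:R *: dg pb) (row_mx (2%:R *: dg qb)
      (row_mx (- dg (Ao^T *m v)) (row_mx (- (dg l *m A2o^T))
        (row_mx 0 0))))))).

Lemma eqdimE : eqdim = (4 * n + 2)%N.
Proof. by rewrite /eqdim; lia. Qed.

Lemma udimE : udim = (4 * n + 2)%N.
Proof. by rewrite /udim; lia. Qed.

(* The block dimensions of the rows and of the columns add up to the same
   number but not convertibly so, hence the (order-preserving) cast. *)
Definition phi_u pb qb l v : 'M[R]_(4 * n + 2) :=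
  castmx (eqdimE, udimE) (phi_u_blocks pb qb l v).

Definition phi_u' (pb qb l : 'cV[R]_n) (v : 'cV[R]_(1 + n)) : 'M[R]_n :=
  dg (Ao^T *m v) + 2%:R *: (dg pb *m invmx A2 *m dg r)
    + 2%:R *: (dg qb *m invmx A2 *m dg x)
  - dg l *m A2o^T *m invmx A2^T
      *m (dg r *m dg r + 2%:R *: (dg r *m invmx A2 *m dg r)
          + dg x *m dg x + 2%:R *: (dg x *m invmx A2 *m dg x)).

Let dgD k (a b : 'cV[R]_k) : dg (a + b) = dg a + dg b.
Proof. by rewrite /dg !linearD. Qed.

Let dgC k (a b : 'cV[R]_k) : dg a *m b = dg b *m a.
Proof. by apply/colP => i; rewrite /dg !mul_diag_mx !mxE mulrC. Qed.

Let trmul0 (B : 'M[R]_(1 + n, n)) (w : 'cV[R]_n) :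
  B^T *m col_mx (0 : 'cV[R]_1) w = (dsubmx B)^T *m w.
Proof. by rewrite -{1}(vsubmxK B) tr_col_mx mul_row_col mulmx0 add0r. Qed.

Let e1M (s : 'cV[R]_1) : e1 *m s = col_mx s 0.
Proof.
rewrite /e1; apply/colP => i; rewrite !mxE big_ord1 !mxE eqxx andbT.
case: splitP => j ij; last by rewrite -val_eqE /= ij !mxE mul0r.
by rewrite -val_eqE /= ij !ord1 mul1r.
Qed.

Let entryE :
  (forall (s t : 'cV[R]_n) i, (s + t) i 0 = s i 0 + t i 0)
  * (forall (s : 'cV[R]_n) i, (- s) i 0 = - s i 0)
  * (forall (s t : 'cV[R]_(1 + n)) i, (s + t) i 0 = s i 0 + t i 0)
  * (forall (s : 'cV[R]_(1 + n)) i, (- s) i 0 = - s i 0)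
  * (forall c (s : 'cV[R]_n) i, (c *: s) i 0 = c * s i 0).
Proof. by do ![split] => *; rewrite !mxE. Qed.

(* [phi] is quadratic, and [phi_u_blocks] is its derivative in u. *)
Lemma phi_taylor u xi h :
  phi (u + h) xi = phi u xi
    + phi_u_blocks (pb_of u) (qb_of u) (l_of u) (v_of u xi) *m h
    + col_mx 0 (col_mx 0 (col_mx 0
        (dg (pb_of h) *m pb_of h + dg (qb_of h) *m qb_of h
         - dg (Ao^T *m v_of h 0) *m l_of h))).
Proof.
rewrite /phi /=.
have -> : pb_of (u + h) = pb_of u + pb_of h by rewrite /pb_of !linearD.
have -> : qb_of (u + h) = qb_of u + qb_of h by rewrite /qb_of !linearD.
have -> : l_of (u + h) = l_of u + l_of h by rewrite /l_of !linearD.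
set hv := usubmx (dsubmx (dsubmx (dsubmx h))).
set hp := usubmx (dsubmx (dsubmx (dsubmx (dsubmx h)))).
set hq := dsubmx (dsubmx (dsubmx (dsubmx (dsubmx h)))).
have -> : v_of (u + h) xi = v_of u xi + col_mx 0 hv.
  by rewrite /v_of !linearD /= add_col_mx addr0.
have -> : v_of h 0 = col_mx 0 hv by rewrite /v_of linear0.
have -> : p_of (u + h) xi = p_of u xi + e1 *m hp.
  by rewrite e1M /p_of !linearD /= add_col_mx addr0.
have -> : q_of (u + h) xi = q_of u xi + e1 *m hq.
  by rewrite e1M /q_of !linearD /= add_col_mx addr0.
have hE : h = col_mx (pb_of h) (col_mx (qb_of h) (col_mx (l_of h)
    (col_mx hv (col_mx hp hq)))) by rewrite /pb_of /qb_of /l_of !vsubmxK.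
move: (pb_of u) (pb_of h) (qb_of u) (qb_of h) (l_of u) (l_of h) hE => a a' b b' l l' hE.
move: (v_of u xi) (p_of u xi) (q_of u xi) => v p q.
rewrite /phi_u_blocks !mul_col_mx hE !mul_row_col !mul0mx !mulmxDr !trmul0.
rewrite -/A2 -/A2o !dgD !mulmxDl !add0r !addr0 !add_col_mx !addr0.
rewrite !mulNmx -!scalemxAl.
congr (col_mx _ (col_mx _ (col_mx _ _))).
- by rewrite /A !mulmxDl !mulNmx; apply/colP => i; rewrite !entryE; ring.
- by rewrite /A !mulmxDl !mulNmx; apply/colP => i; rewrite !entryE; ring.
- by apply/colP => i; rewrite !entryE; ring.
rewrite (dgC a' a) (dgC b' b) (dgC (A2o^T *m hv) l) -mulmxA.
by apply/colP => i; rewrite !entryE; ring.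
Qed.

End Matrices.

Section Subtree.
Variables (R : fieldType) (n : nat) (E : rel 'I_n.+1).

(* A set S of non-root nodes, together with node 0, is renumbered as
   'I_#|S|.+1, with 0 kept as root and the elements of S in increasing order. *)
Definition sub_edge (S : {set 'I_n}) : 'I_#|S| -> 'I_n := @enum_val _ (mem S).
Definition sub_node (S : {set 'I_n}) (k : 'I_#|S|.+1) : 'I_n.+1 :=
  if unlift ord0 k is Some e then child (sub_edge e) else ord0.

Definition subtree (i : 'I_n.+1) : {set 'I_n} := [set e | connect E i (child e)].

Definition phi_u'_at (i : 'I_n.+1) (r x pb qb l : 'cV[R]_n)
    (v : 'cV[R]_(1 + n)) : 'M[R]_#|subtree i| :=
  let edge := @sub_edge (subtree i) in let node := @sub_node (subtree i) in
  phi_u' (fun j k => E (node j) (node k))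
    (rowsub edge r) (rowsub edge x)
    (rowsub edge pb) (rowsub edge qb) (rowsub edge l) (rowsub node v).

End Subtree.

Section Stability.
Variables (R : realType) (n : nat) (E : rel 'I_n.+1) (r x : 'cV[R]_n).

Definition nonsingular_operating_points : set ('cV[R]_(udim n) * 'cV[R]_(xidim n)) :=
  [set z | let: (u, xi) := z in
    [/\ phi E r x u xi = 0,
        v_of u xi ord0 0 = 1,
        forall i, 0 <= v_of u xi i 0,
        forall e, 0 <= l_of u e 0
      & \det (phi_u E r x (pb_of u) (qb_of u) (l_of u) (v_of u xi)) != 0]].

Definition flat_solution : 'cV[R]_(udim n) * 'cV[R]_(xidim n) :=
  (mk_u 0 0 0 (const_mx 1) 0 0, mk_xi (const_mx 1) 0 0).

Definition voltage_stability_region : set ('cV[R]_(udim n) * 'cV[R]_(xidim n)) :=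
  connected_component nonsingular_operating_points flat_solution.

End Stability.

(* Main.v *)
Require Import Defs.
From mathcomp Require Import all_boot all_order all_fingroup all_algebra.
From mathcomp Require Import all_classical all_reals all_analysis.
From mathcomp Require Import zify.

Set Implicit Arguments.
Unset Strict Implicit.
Unset Printing Implicit Defensive.

Import Order.TTheory GRing.Theory Num.Theory.
Import numFieldNormedType.Exports.

Local Open Scope classical_set_scope.
Local Open Scope ring_scope.

(** Everything rests on the square matrix [A2 = A2o - 1], where [A2o] is the
    adjacency matrix of the tree on the non-root nodes. Along an edge the depth
    strictly increases, so in the Leibniz formula only the identity permutation
    contributes, and [\det A2 = (-1) ^+ n] ([det_A2]).

    For (i), the columns of [phi_u] that belong to [p_0] and [q_0] each have a
    single nonzero entry, -1, in the rows of the two balance equations at the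
    root. Expanding along them leaves a square matrix made of blocks of size
    [n] ([det_phi_u_core]). Two Schur complements with pivot [- A2] eliminate
    the active and reactive powers, and a third one with pivot [A2^T] eliminates
    the voltages; what remains of the current column is exactly [phi_u']
    ([det_core_phi_u']). The expansion and the last elimination each contribute
    [(-1) ^+ n], and these signs cancel.

    For (iii), the non-root nodes are partitioned into the branches hanging off
    the root, and no edge joins two branches. Let [P] be the 0-1 matrix that
    restricts an edge vector to a branch [S]. Then [P *m B = B_S *m P] for each
    of the matrices [B] out of which [phi_u'] is built, [B_S] being the
    same matrix for the branch. Such relations are stable under sums, products
    and inverses, so [P *m phi_u' = phi_u'_S *m P] ([intertwines_phi_u']).
    A vector in the left kernel of a block, multiplied by [P], lies in the left
    kernel of [phi_u']; conversely a nonzero vector in the right kernel of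
    [phi_u'] has a nonzero restriction to some branch, which lies in the right
    kernel of that block.

    For (ii), [\det phi_u'] is a polynomial in the coordinates, hence continuous;
    at the flat solution [phi_u'] is the identity, and by (i) the determinant
    has no zero on the stability region. The image of a connected set containing
    the flat solution is then an interval that contains 1 but not 0. *)

(** * Determinants of block and of sparse matrices *)

Lemma det_schur_ul (R : comUnitRingType) m n (A : 'M[R]_m) B C (D : 'M[R]_n) :
  A \in unitmx ->
  \det (block_mx A B C D) = \det A * \det (D - C *m invmx A *m B).
Proof.
move=> uA; rewrite -[LHS]mulr1.
have <- : \det (block_mx 1%:M (- (invmx A *m B)) 0 1%:M : 'M[R]_(m + n)) = 1.
  by rewrite det_ublock !det1 mulr1.
rewrite -det_mulmx mulmx_block !mulmx1 !mulmx0 !addr0 !mulmxN !mulmxA.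
by rewrite mulmxV // mul1mx addNr det_lblock addrC.
Qed.

(** The pivot is off the diagonal: exchanging the two block columns with the
    sign change of [block_mx 0 (- 1) 1 0], a product of unipotent matrices,
    costs no sign, whatever the parity of [n]. *)
Lemma det_schur_ur (R : comUnitRingType) n (A B C D : 'M[R]_n) :
  B \in unitmx ->
  \det (block_mx A B C D) = \det B * \det (D *m invmx B *m A - C).
Proof.
move=> uB.
pose U : 'M[R]_(n + n) := block_mx 1%:M (- 1%:M) 0 1%:M.
pose L : 'M[R]_(n + n) := block_mx 1%:M 0 1%:M 1%:M.
rewrite -[LHS]mulr1.
have <- : \det (U *m L *m U) = 1.
  by rewrite !det_mulmx !det_ublock det_lblock !det1 !mulr1.
have -> : U *m L *m U = block_mx 0 (- 1%:M) 1%:M 0.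
  rewrite !mulmx_block !(mul0mx, mulmx0, mul1mx, mulmx1, mulNmx, mulmxN).
  by rewrite !(add0r, addr0, subrr, addNr, oppr0).
rewrite -det_mulmx mulmx_block !(mulmx0, mulmx1, mulmxN) !(add0r, addr0).
by rewrite det_schur_ul // mulmxN opprK addrC.
Qed.

Lemma det_expand_sparse_col (R : comNzRingType) n (M : 'M[R]_n) i0 j0 :
  (forall i, i != i0 -> M i j0 = 0) ->
  \det M = M i0 j0 * (-1) ^+ (i0 + j0) * \det (row' i0 (col' j0 M)).
Proof.
move=> M0; rewrite (expand_det_col M j0) (bigD1 i0) //= big1 ?addr0 ?mulrA //.
by move=> i /M0 ->; rewrite mul0r.
Qed.

(** A matrix whose two dimensions are equal but not convertible has a
    determinant only through a cast; casting rows and columns to any third size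
    gives the same value as identifying the row size with the column size. *)
Lemma det_castmx_rows (R : comNzRingType) a b m (ea : a = m) (eb : b = m)
    (eab : a = b) (M : 'M[R]_(a, b)) :
  \det (castmx (ea, eb) M) = \det (castmx (eab, erefl b) M).
Proof. by case: b / eab eb M => eb M; case: m / ea eb => eb; rewrite (eq_axiomK eb). Qed.

Lemma det_castmx_sq (R : comNzRingType) a m (ea eb : a = m) (M : 'M[R]_a) :
  \det (castmx (ea, eb) M) = \det M.
Proof. by rewrite (det_castmx_rows _ _ erefl) castmx_id. Qed.

(** The expansion is stated for a non-square type, so that it applies to the
    block matrix itself and can be iterated with the cast left outside. *)
Lemma det_castmx_expand (R : comNzRingType) a b (e : a = b) (M : 'M[R]_(a, b))
    (i0 : 'I_a) (j0 : 'I_b) :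
  (forall i, i != i0 -> M i j0 = 0) ->
  \det (castmx (e, erefl b) M) = M i0 j0 * (-1) ^+ (i0 + j0)
     * \det (castmx (congr1 predn e, erefl b.-1) (row' i0 (col' j0 M))).
Proof.
by case: b / e M j0 => M j0 M0; rewrite !castmx_id; exact: det_expand_sparse_col.
Qed.

Lemma col_row_mx (R : Type) m1 m2 n1 n2 (a : 'M[R]_(m1, n1)) (b : 'M[R]_(m1, n2))
    (c : 'M[R]_(m2, n1)) (d : 'M[R]_(m2, n2)) :
  col_mx (row_mx a b) (row_mx c d) = row_mx (col_mx a c) (col_mx b d).
Proof. exact: block_mxEh. Qed.

(** * The incidence matrix of a rooted tree *)

Section Tree.
Variables (n : nat) (E : rel 'I_n.+1).
Hypothesis treeE : rooted_tree E.

Lemma parent_uniq i k j : E i j -> E k j -> i = k.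
Proof.
have [root0 parent _] := treeE => Eij Ekj.
have j0 : j != ord0 by apply: contraTneq Eij => ->; exact: root0.
by have [p [_ p_uniq]] := parent j j0; rewrite -(p_uniq _ Eij) -(p_uniq _ Ekj).
Qed.

(** The depth of a node is the length of a shortest path from the root: since
    parents are unique, a shortest path to a node runs through its parent. *)
Lemma exists_depth :
  exists d : 'I_n.+1 -> nat, forall i j, E i j -> (d i < d j)%N.
Proof.
have [root0 _ conn] := treeE.
have ex_path j : exists k, `[< exists2 p, path E ord0 p &
    last ord0 p = j /\ size p = k >].
  by have /connectP[p pp jE] := conn j; exists (size p); apply/asboolP; exists p.
exists (fun j => ex_minn (ex_path j)) => i j Eij.
case: (ex_minnP (ex_path j)) => k /asboolP[p pp [pj <-]] _.
case: (ex_minnP (ex_path i)) => k' _ min_k'.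
case/lastP: p pp pj => [_ /= j0|p j' pp].
  by move: Eij; rewrite -j0 (negPf (root0 i)).
rewrite last_rcons => jE; move: pp; rewrite rcons_path jE => /andP[pp Epj].
rewrite size_rcons ltnS; apply: min_k'; apply/asboolP; exists p => //.
by rewrite (parent_uniq Eij Epj).
Qed.

Variable R : fieldType.

Lemma A2E : A2 R E = A2o R E - 1%:M.
Proof. by apply/matrixP => i j; rewrite !mxE; congr (_ - _). Qed.

Lemma A2oE i j : A2o R E i j = (E (child i) (child j))%:R.
Proof. by rewrite !mxE; congr (E _ _)%:R; apply/val_inj. Qed.

(** If [s] contributes to the Leibniz formula, each [s i] is [i] or a child of
    [i], so depth does not decrease along [s]; as [s] preserves the sum of the
    depths, equality holds everywhere and [s] is the identity. *)
Lemma det_A2 : \det (A2 R E) = (-1) ^+ n.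
Proof.
have [d dE] := exists_depth.
rewrite /determinant (bigD1 1%g) //= [X in _ + X]big1 => [|s sN1].
  rewrite odd_perm1 mul1r addr0 -[in RHS](card_ord n) -prodr_const.
  apply: eq_bigr => i _; rewrite perm1 A2E [LHS]mxE A2oE !mxE eqxx.
  rewrite (_ : E _ _ = false) ?add0r //; apply/negP => /dE.
  by rewrite ltnn.
apply/eqP; rewrite mulf_eq0 signr_eq0 /=; apply/negPn/negP => /prodf_neq0 s_neq0.
have le_d i : (d (child i) <= d (child (s i)) ?= iff (s i == i))%N.
  have := s_neq0 i isT; rewrite A2E [_ i (s i)]mxE A2oE !mxE eq_sym.
  have [->|_] := eqVneq (s i) i; first by rewrite /leqif eqxx leqnn.
  rewrite subr0; case: (boolP (E _ _)) => [/dE lt_d _|]; last by rewrite eqxx.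
  by split; [exact: ltnW|rewrite ltn_eqF].
have [_] := leqif_sum (fun i (_ : xpredT i) => le_d i).
rewrite -[X in X == _](_ : \sum_i d (child (s i)) = _)%N ?eqxx; last first.
  by rewrite [RHS](reindex_inj (@perm_inj _ s)).
move=> /esym/forallP fix_s.
case/eqP: sN1; apply/permP => i; rewrite perm1; exact/eqP/(implyP (fix_s i)).
Qed.

Lemma A2_unit : A2 R E \in unitmx.
Proof. by rewrite unitmxE det_A2 unitrX // unitrN1. Qed.

End Tree.

(** * From the full Jacobian to the reduced one *)

Lemma dsub_Ai (R : fieldType) n : dsubmx (Ai R n) = 1%:M.
Proof. by apply/matrixP => i j; rewrite !mxE. Qed.

Section Core.
Variables (R : fieldType) (n : nat) (E : rel 'I_n.+1).
Variables (r x pb qb l : 'cV[R]_n) (v : 'cV[R]_(1 + n)).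

(** The block matrix of [phi_u] without the balance equations at the root
    and without the columns of [p_0] and [q_0]; there [Ai] becomes the identity
    and [A] becomes [A2]. *)
Definition phi_u_core : 'M[R]_(n + (n + (n + n))) :=
  col_mx
    (row_mx (- A2 R E) (row_mx 0 (row_mx (- dg r) 0)))
 (col_mx
    (row_mx 0 (row_mx (- A2 R E) (row_mx (- dg x) 0)))
 (col_mx
    (row_mx (- 2%:R *: dg r) (row_mx (- 2%:R *: dg x)
      (row_mx (dg r *m dg r + dg x *m dg x) (A2 R E)^T)))
    (row_mx (2%:R *: dg pb) (row_mx (2%:R *: dg qb)
      (row_mx (- dg ((Ao R E)^T *m v)) (- (dg l *m (A2o R E)^T))))))).

(* Balance rows at the root and columns of [p_0] and [q_0]. *)
Let ip : 'I_(eqdim n) := lshift _ (lshift n ord0).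
Let iq : 'I_(eqdim n) := rshift (1 + n) (lshift _ (lshift n ord0)).
Let jp : 'I_(udim n) := rshift n (rshift n (rshift n (rshift n (lshift 1 ord0)))).
Let jq : 'I_(udim n) := rshift n (rshift n (rshift n (rshift n (rshift 1 ord0)))).

Let B := phi_u_blocks E r x pb qb l v.

Let colp i : B i jp = - (i == ip)%:R.
Proof.
rewrite /B /phi_u_blocks /jp.
case: (split_ordP i) => {}i ->; rewrite ?col_mxEu ?col_mxEd.
  rewrite !row_mxEr row_mxEl !mxE andbT; congr (- (_)%:R).
case: (split_ordP i) => {}i ->; rewrite ?col_mxEu ?col_mxEd.
  by rewrite !row_mxEr row_mxEl !mxE /ip eq_rlshift oppr0.
by case: (split_ordP i) => {}i ->; rewrite ?col_mxEu ?col_mxEd;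
   rewrite !row_mxEr row_mxEl !mxE /ip eq_rlshift oppr0.
Qed.

Let colq i : B i jq = - (i == iq)%:R.
Proof.
rewrite /B /phi_u_blocks /jq.
case: (split_ordP i) => {}i ->; rewrite ?col_mxEu ?col_mxEd.
  by rewrite !row_mxEr !mxE /iq eq_lrshift oppr0.
case: (split_ordP i) => {}i ->; rewrite ?col_mxEu ?col_mxEd.
  rewrite !row_mxEr !mxE andbT; congr (- (_)%:R).
  by rewrite /iq eq_rshift.
by case: (split_ordP i) => {}i ->; rewrite ?col_mxEu ?col_mxEd;
   rewrite !row_mxEr !mxE /iq ?eq_rshift eq_rlshift oppr0.
Qed.

(** The entries -1 sit at positions (0, 4n) and, after the first deletion,
    (n, 4n), which accounts for the sign [(-1) ^+ n]. *)
Lemma det_phi_u_core :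
  \det (phi_u E r x pb qb l v) = (-1) ^+ n * \det phi_u_core.
Proof.
have eU : eqdim n = udim n by rewrite eqdimE udimE.
have [i1 iqE _] : {i1 | iq = lift ip i1 & unlift ip iq = Some i1}.
  by apply: unlift_some; rewrite /ip eq_lrshift.
have [j1 jqE _] : {j1 | jq = lift jp j1 & unlift jp jq = Some j1}.
  by apply: unlift_some; rewrite /jp /jq !eq_rshift eq_lrshift.
have i1E : i1 = n :> nat.
  by have := congr1 val iqE; rewrite /= /bump /=; lia.
have j1E : j1 = (4 * n)%N :> nat.
  by have := congr1 val jqE; rewrite /= /bump; case: leqP => /=; lia.
have eC : (n + (n + (n + n)) = (eqdim n).-1.-1)%N by rewrite /eqdim; lia.
have eC' : (n + (n + (n + n)) = (udim n).-1.-1)%N by rewrite /udim; lia.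
(* Both deleted columns come last, so column indices are unchanged; the deleted
   rows are the first one of each of the two first blocks, so row indices shift
   by one, and by two from the second block on. *)
have colE (j : 'I_(n + (n + (n + n)))) (k : 'I_(udim n)) :
    k = j :> nat -> lift jp (lift j1 (cast_ord eC' j)) = k.
  move=> kj; apply/val_inj; rewrite /= j1E /bump /= kj.
  by have := ltn_ord j; lia.
have rowE (i : 'I_(n + (n + (n + n)))) (k : 'I_(eqdim n)) :
    k = (i + 1 + (n <= i))%N :> nat -> lift ip (lift i1 (cast_ord eC i)) = k.
  by move=> ki; apply/val_inj; rewrite /= i1E /bump /= ki; lia.
have cl := (row_mxEl, row_mxEr).
have colX m (X1 X2 X3 X4 : 'M[R]_(m, n)) (X5 X6 : 'cV[R]_m) i j :
    row_mx X1 (row_mx X2 (row_mx X3 (row_mx X4 (row_mx X5 X6)))) i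
      (lift jp (lift j1 (cast_ord eC' j)))
    = row_mx X1 (row_mx X2 (row_mx X3 X4)) i j.
  case: (split_ordP j) => {}j ->; first by rewrite (colE _ (lshift _ j)) ?cl.
  case: (split_ordP j) => {}j ->.
    by rewrite (colE _ (rshift n (lshift _ j))) ?cl.
  case: (split_ordP j) => {}j ->.
    by rewrite (colE _ (rshift n (rshift n (lshift _ j)))) ?cl.
  by rewrite (colE _ (rshift n (rshift n (rshift n (lshift _ j))))) ?cl.
have coreE i j : B (lift ip (lift i1 (cast_ord eC i)))
    (lift jp (lift j1 (cast_ord eC' j))) = phi_u_core i j.
  rewrite /B /phi_u_blocks /phi_u_core.
  have rowS (y : 'cV[R]_n) (k : 'I_n) :
      forall k', (- (Ai R n *m dg y)) (rshift 1 k) k' = (- dg y) k k'.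
    move=> k'; rewrite [LHS]mxE [RHS]mxE; congr (- _).
    by rewrite -[dg y in RHS]mul1mx -dsub_Ai mul_dsub_mx [RHS]mxE.
  have rowA (k k' : 'I_n) : (- A R E) (rshift 1 k) k' = (- A2 R E) k k'.
    by rewrite [LHS]mxE [RHS]mxE; congr (- _); rewrite [RHS]mxE.
  have row0 (k k' : 'I_n) :
    (0 : 'M[R]_(1 + n, n)) (rshift 1 k) k' = (0 : 'M[R]_n) k k' by rewrite !mxE.
  case: (split_ordP i) => {}i ->.
    rewrite (rowE _ (lshift _ (rshift 1 i))) /= ?(col_mxEu, colX).
      by case: (split_ordP j) => {}j ->; rewrite !cl ?(rowA, row0, rowS) //;
         case: (split_ordP j) => {}j ->; rewrite !cl ?(rowA, row0, rowS) //;
         case: (split_ordP j) => {}j ->; rewrite !cl ?(rowA, row0, rowS) //.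
    by have := ltn_ord i; lia.
  case: (split_ordP i) => {}i ->.
    rewrite (rowE _ (rshift (1 + n) (lshift _ (rshift 1 i)))) /=
      ?(col_mxEu, col_mxEd, colX).
      by case: (split_ordP j) => {}j ->; rewrite !cl ?(rowA, row0, rowS) //;
         case: (split_ordP j) => {}j ->; rewrite !cl ?(rowA, row0, rowS) //;
         case: (split_ordP j) => {}j ->; rewrite !cl ?(rowA, row0, rowS) //.
    by have := ltn_ord i; lia.
  rewrite (rowE _ (rshift (1 + n) (rshift (1 + n) i))) /=; last by lia.
  rewrite !col_mxEd.
  by case: (split_ordP i) => {}i ->; rewrite ?(col_mxEu, col_mxEd) colX.
rewrite /phi_u (det_castmx_rows _ _ eU) -/B.
rewrite (det_castmx_expand eU (i0 := ip) (j0 := jp)); last first.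
  by move=> i /negPf i_neq; rewrite colp i_neq oppr0.
rewrite (det_castmx_expand _ (i0 := i1) (j0 := j1)); last first.
  move=> i /negPf i_neq; rewrite 2!mxE -jqE colq iqE (inj_eq lift_inj) i_neq.
  by rewrite oppr0.
have -> : row' i1 (col' j1 (row' ip (col' jp B))) = castmx (eC, eC') phi_u_core.
  rewrite castmxEsub; apply/matrixP => i j; rewrite [RHS]mxE -coreE !cast_ordKV.
  by do 4!rewrite [LHS]mxE.
rewrite castmx_comp det_castmx_sq.
rewrite colp 2!mxE -iqE -jqE colq !eqxx i1E j1E.
rewrite (_ : ip + jp = 2 * (2 * n))%N; last by rewrite /=; lia.
rewrite (_ : n + 4 * n = n + 2 * (2 * n))%N; last by lia.
rewrite exprD !exprM sqrrN !expr1n /= !mulr1n !mulr1.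
by rewrite !mulN1r mulNr opprK.
Qed.

(** Eliminating [pb] and [qb] turns the impedance block into the matrix
    [dg r *m dg r + 2 *: (dg r *m invmx A2 *m dg r) + ...] of [phi_u'];
    eliminating [v] with pivot [A2^T] then produces [phi_u'] itself. *)
Lemma det_core_phi_u' : rooted_tree E ->
  \det phi_u_core = (-1) ^+ n * \det (phi_u' E r x pb qb l v).
Proof.
move=> treeE; have uA2 := A2_unit treeE R.
have detNA2 : \det (- A2 R E) = 1.
  by rewrite -scaleN1r detZ det_A2 // -exprMn mulrNN mulr1 expr1n.
have uNA2 : - A2 R E \in unitmx by rewrite unitmxE detNA2 unitr1.
have uTA2 : (A2 R E)^T \in unitmx by rewrite unitmx_tr.
have -> : phi_u_core =
    block_mx (- A2 R E) (row_mx 0 (row_mx (- dg r) 0))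
      (col_mx 0 (col_mx (- 2%:R *: dg r) (2%:R *: dg pb)))
      (block_mx (- A2 R E) (row_mx (- dg x) 0)
        (col_mx (- 2%:R *: dg x) (2%:R *: dg qb))
        (block_mx (dg r *m dg r + dg x *m dg x) (A2 R E)^T
          (- dg ((Ao R E)^T *m v)) (- (dg l *m (A2o R E)^T)))).
  by rewrite /phi_u_core /block_mx !col_row_mx.
rewrite det_schur_ul // detNA2 mul1r.
have -> : col_mx 0 (col_mx (- 2%:R *: dg r) (2%:R *: dg pb))
    *m invmx (- A2 R E) *m row_mx 0 (row_mx (- dg r) 0)
  = block_mx 0 0 0 (block_mx (- 2%:R *: dg r *m invmx (- A2 R E) *m (- dg r)) 0
      (2%:R *: dg pb *m invmx (- A2 R E) *m (- dg r)) 0) :> 'M[R]_(n + (n + n)).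
  rewrite /block_mx !(mul_col_mx, mul_mx_row, mul0mx, mulmx0).
  rewrite !col_row_mx -[X in col_mx X (row_mx _ _)](row_mx0 R n n n) col_row_mx.
  by rewrite !col_mx0.
rewrite opp_block_mx add_block_mx !oppr0 !addr0 opp_block_mx add_block_mx.
rewrite !oppr0 !addr0 det_schur_ul // detNA2 mul1r.
rewrite mul_col_mx mul_col_row !mulmx0.
rewrite opp_block_mx add_block_mx !oppr0 !addr0.
rewrite det_schur_ur // det_tr det_A2 //; congr (_ * \det _).
have -> : invmx (- A2 R E) = - invmx (A2 R E).
  apply: (can_inj (mulKmx uNA2)).
  by rewrite mulmxV // mulNmx mulmxN opprK mulmxV.
rewrite /phi_u' !(scaleNr, mulNmx, mulmxN, opprK) -!scalemxAl.
rewrite !opprD !opprK addrC; congr (_ - _ *m _).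
by congr (_ + _); rewrite addrAC.
Qed.

Lemma det_phi_u : rooted_tree E ->
  \det (phi_u E r x pb qb l v) = \det (phi_u' E r x pb qb l v).
Proof.
move=> treeE; rewrite det_phi_u_core det_core_phi_u' // mulrA -exprMn.
by rewrite mulrNN mulr1 expr1n mul1r.
Qed.

End Core.

(** * Matrices intertwined by a restriction *)

Section Intertwine.
Variables (R : fieldType) (m n : nat) (P : 'M[R]_(m, n)).

Definition intertwines (X : 'M[R]_n) (X' : 'M[R]_m) := P *m X = X' *m P.

Lemma intertwinesD X Y X' Y' :
  intertwines X X' -> intertwines Y Y' -> intertwines (X + Y) (X' + Y').
Proof. by move=> hX hY; rewrite /intertwines mulmxDr mulmxDl hX hY. Qed.

Lemma intertwinesN X X' : intertwines X X' -> intertwines (- X) (- X').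
Proof. by move=> hX; rewrite /intertwines mulmxN mulNmx hX. Qed.

Lemma intertwinesZ a X X' : intertwines X X' -> intertwines (a *: X) (a *: X').
Proof. by move=> hX; rewrite /intertwines -scalemxAr -scalemxAl hX. Qed.

Lemma intertwinesM X Y X' Y' :
  intertwines X X' -> intertwines Y Y' -> intertwines (X *m Y) (X' *m Y').
Proof.
by move=> hX hY; rewrite /intertwines mulmxA hX -mulmxA hY mulmxA.
Qed.

Lemma intertwines1 : intertwines 1%:M 1%:M.
Proof. by rewrite /intertwines mulmx1 mul1mx. Qed.

Hypothesis PPT : P *m P^T = 1%:M.

(** A right inverse of [P] carries [invmx X] to an inverse of [X'], so a branch
    inherits invertibility from the whole tree. *)
Lemma intertwines_unit X X' :
  intertwines X X' -> X \in unitmx -> X' \in unitmx.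
Proof.
move=> hX uX; suff /mulmx1_unit[] : X' *m (P *m invmx X *m P^T) = 1%:M by [].
by rewrite !mulmxA -hX -(mulmxA P) mulmxV // mulmx1.
Qed.

Lemma intertwinesV X X' :
  X \in unitmx -> intertwines X X' -> intertwines (invmx X) (invmx X').
Proof.
move=> uX hX; have uX' := intertwines_unit hX uX.
apply: (can_inj (mulKmx uX')).
by rewrite !mulmxA -hX -(mulmxA P) mulmxV // mulmxV // mulmx1 mul1mx.
Qed.

End Intertwine.

(** * Restriction of the reduced Jacobian to a branch *)

Section Branch.
Variables (R : fieldType) (n : nat) (E : rel 'I_n.+1) (S : {set 'I_n}).
Hypothesis closedS :
  forall e f, E (child e) (child f) -> (e \in S) = (f \in S).

Let edge := @sub_edge n S.
Let ES : rel 'I_#|S|.+1 := fun j k => E (sub_node j) (sub_node k).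
Let P : 'M[R]_(#|S|, n) := rowsub edge 1%:M.

Let PE s f : P s f = (edge s == f)%:R. Proof. by rewrite !mxE. Qed.

Let edge_inj : injective edge. Proof. exact: enum_val_inj. Qed.

Let node_child s : @sub_node n S (child s) = child (edge s).
Proof. by rewrite /sub_node /child liftK. Qed.

Lemma rowsub_tr1 : P *m P^T = 1%:M.
Proof.
apply/matrixP => s t; rewrite -rowsubE !mxE.
by rewrite (inj_eq edge_inj) eq_sym.
Qed.

Lemma intertwines_dg (y : 'cV[R]_n) : intertwines P (dg y) (dg (rowsub edge y)).
Proof.
rewrite /intertwines -rowsubE mul_diag_mx; apply/matrixP => s f.
rewrite !mxE; have [->|ne] := eqVneq (edge s) f; first by rewrite mulr1.
by rewrite mulr0n mulr0.
Qed.

(** If the rows of [B] indexed by [S] vanish outside [S], nothing is lost by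
    restricting the columns too. *)
Lemma intertwines_block (B : 'M[R]_n) :
  (forall e f, e \in S -> f \notin S -> B e f = 0) ->
  intertwines P B (mxsub edge edge B).
Proof.
move=> B0; rewrite /intertwines -rowsubE; apply/matrixP => s f.
rewrite !mxE; under eq_bigr do rewrite PE mxE.
have [fS|fNS] := boolP (f \in S).
  rewrite (bigD1 (enum_rank_in fS f)) //= big1 => [|t]; rewrite /edge /sub_edge.
    by rewrite enum_rankK_in // eqxx mulr1 addr0.
  move=> /eqP t_neq; case: eqP => [tf|]; last by rewrite mulr0.
  by case: t_neq; apply: edge_inj; rewrite /edge /sub_edge enum_rankK_in.
rewrite B0 ?enum_valP // big1 // => t _; case: eqP => [tf|]; last by rewrite mulr0.
by rewrite -tf enum_valP in fNS.
Qed.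

Lemma A2o_branch : A2o R ES = mxsub edge edge (A2o R E).
Proof. by apply/matrixP => s t; rewrite A2oE [RHS]mxE A2oE /ES !node_child. Qed.

Lemma intertwines_A2o : intertwines P (A2o R E) (A2o R ES).
Proof.
rewrite A2o_branch; apply: intertwines_block => e f eS fNS; rewrite A2oE.
by case: (boolP (E _ _)) => // /closedS; rewrite eS (negPf fNS).
Qed.

Lemma intertwines_A2oT : intertwines P (A2o R E)^T (A2o R ES)^T.
Proof.
rewrite A2o_branch trmx_mxsub; apply: intertwines_block => e f eS fNS.
rewrite mxE A2oE.
by case: (boolP (E _ _)) => // /closedS; rewrite eS (negPf fNS).
Qed.

Lemma intertwines_A2 : intertwines P (A2 R E) (A2 R ES).
Proof.
by rewrite !A2E; apply/intertwinesD/intertwinesN/intertwines1/intertwines_A2o.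
Qed.

Lemma intertwines_A2T : intertwines P (A2 R E)^T (A2 R ES)^T.
Proof.
rewrite !A2E !linearB /= !trmx1.
by apply/intertwinesD/intertwinesN/intertwines1/intertwines_A2oT.
Qed.

(** The parent of a node of [S] is the root or lies in [S], so the sending-end
    voltages of the branch only involve the voltages kept by the restriction. *)
Lemma AoTv_branch (v : 'cV[R]_(1 + n)) :
  rowsub edge ((Ao R E)^T *m v) = (Ao R ES)^T *m rowsub (@sub_node n S) v.
Proof.
have AoTvE m (F : rel 'I_m.+1) (w : 'cV[R]_(1 + m)) e :
    ((Ao R F)^T *m w) e 0
    = (F ord0 (child e))%:R * w ord0 0 + ((A2o R F)^T *m dsubmx w) e 0.
  rewrite !mxE big_ord_recl !mxE; congr (_ + _).
  apply: eq_bigr => k _; rewrite !mxE.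
  by rewrite (_ : lift ord0 k = rshift 1 k) //; apply/val_inj.
apply/matrixP => s j; rewrite !ord1 mxE !AoTvE; congr (_ + _).
  by rewrite [_ ord0 0 in RHS]mxE /ES node_child /sub_node unlift_none.
have -> : dsubmx (rowsub (@sub_node n S) v : 'cV[R]_(1 + #|S|)) = P *m dsubmx v.
  rewrite -rowsubE; apply/matrixP => t k; rewrite !mxE.
  congr (v _ _); transitivity (child (edge t)); last exact/val_inj.
  by rewrite -node_child; congr sub_node; apply/val_inj.
by rewrite mulmxA -intertwines_A2oT -mulmxA -rowsubE [RHS]mxE.
Qed.

Hypothesis treeE : rooted_tree E.

Lemma intertwines_phi_u' (r x pb qb l : 'cV[R]_n) (v : 'cV[R]_(1 + n)) :
  intertwines P (phi_u' E r x pb qb l v)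
    (phi_u' ES (rowsub edge r) (rowsub edge x) (rowsub edge pb)
      (rowsub edge qb) (rowsub edge l) (rowsub (@sub_node n S) v)).
Proof.
have iA2 := intertwinesV rowsub_tr1 (A2_unit treeE R) intertwines_A2.
have uA2T : (A2 R E)^T \in unitmx by rewrite unitmx_tr A2_unit.
have iA2T := intertwinesV rowsub_tr1 uA2T intertwines_A2T.
have iq (y z : 'cV[R]_n) : intertwines P (2%:R *: (dg y *m invmx (A2 R E) *m dg z))
    (2%:R *: (dg (rowsub edge y) *m invmx (A2 R ES) *m dg (rowsub edge z))).
  apply: intertwinesZ; apply: intertwinesM; last exact: intertwines_dg.
  by apply: intertwinesM; first exact: intertwines_dg.
have isq (y : 'cV[R]_n) :
    intertwines P (dg y *m dg y) (dg (rowsub edge y) *m dg (rowsub edge y)).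
  by apply: intertwinesM; exact: intertwines_dg.
rewrite /phi_u' -AoTv_branch.
apply: intertwinesD.
  by do 2!apply: intertwinesD => //; exact: intertwines_dg.
apply/intertwinesN/intertwinesM; last by do 3!apply: intertwinesD => //.
do 2!apply: intertwinesM => //; first exact: intertwines_dg.
exact: intertwines_A2oT.
Qed.

End Branch.

(** * Singularity of the reduced Jacobian, branch by branch *)

Section Branches.
Variables (R : fieldType) (n : nat) (E : rel 'I_n.+1).
Hypothesis treeE : rooted_tree E.

(** Descending an edge extends a path from [i]; ascending it removes the last
    step of such a path, which is nonempty because the parent of [i] is the
    root, which is no [child]. *)
Lemma subtree_closed i e f : E ord0 i ->
  E (child e) (child f) -> (e \in subtree E i) = (f \in subtree E i).
Proof.
have [root0 _ _] := treeE => E0i Eef; rewrite !inE.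
apply/idP/idP => [/connect_trans-> //|]; first exact: connect1.
case/connectP => p; case/lastP: p => [_ /= fi|p j].
  by move: Eef; rewrite fi => /(parent_uniq treeE E0i).
rewrite rcons_path last_rcons => /andP[pp Ej fj]; move: Ej; rewrite -fj.
by move=> /(parent_uniq treeE Eef) ->; apply/connectP; exists p.
Qed.

Lemma subtree_cover e : exists2 i, E ord0 i & e \in subtree E i.
Proof.
have [_ _ conn] := treeE; have /connectP[[|i p] /=] := conn (child e).
  by move=> _ /(congr1 val).
move=> /andP[E0i pp] eE; exists i => //; rewrite inE.
by apply/connectP; exists p.
Qed.

(** Left kernel vectors extend from a branch to the tree, right kernel vectors
    restrict from the tree to a branch; using both kinds avoids comparing two
    different branches. *)
Lemma det_phi_u'_eq0 (r x pb qb l : 'cV[R]_n) (v : 'cV[R]_(1 + n)) :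
  \det (phi_u' E r x pb qb l v) = 0 <->
  exists i : 'I_n.+1, E ord0 i /\ \det (phi_u'_at E i r x pb qb l v) = 0.
Proof.
have twine i (E0i : E ord0 i) := intertwines_phi_u'
  (fun e f => @subtree_closed i e f E0i) treeE r x pb qb l v.
split=> [/eqP|[i [E0i /eqP/det0P[w w_neq0 wM]]]].
  rewrite -det_tr => /det0P[w w_neq0 /(congr1 trmx)].
  rewrite trmx_mul trmxK trmx0 => Mw.
  have [e we] : exists e, w 0 e != 0 by apply/rV0Pn.
  have [i E0i eS] := subtree_cover e.
  exists i; split => //; apply/eqP; rewrite -det_tr; apply/det0P.
  exists (rowsub (@sub_edge n (subtree E i)) w^T)^T; last first.
    apply: trmx_inj; rewrite trmx_mul !trmxK trmx0 rowsubE mulmxA.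
    by rewrite -[X in X *m _](twine i E0i) -mulmxA Mw mulmx0.
  apply/rV0Pn; exists (enum_rank_in eS e); rewrite !mxE.
  by rewrite /sub_edge enum_rankK_in.
apply/eqP/det0P; exists (w *m rowsub (@sub_edge n (subtree E i)) 1%:M).
  apply: contraNneq w_neq0 => /(congr1 (mulmx^~ (rowsub (@sub_edge n (subtree E i)) 1%:M)^T)).
  by rewrite mul0mx -mulmxA rowsub_tr1 mulmx1 => ->.
by rewrite -mulmxA (twine i E0i) mulmxA wM mul0mx.
Qed.

End Branches.

(** * Continuity of matrix expressions *)

Section EntrywiseContinuity.
Variables (R : realType) (T : topologicalType).

Definition mx_continuous m n (F : T -> 'M[R]_(m, n)) :=
  forall i j, continuous (fun z => F z i j).

Lemma continuous_sum (I : Type) (s : seq I) (P : pred I) (f : I -> T -> R) :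
  (forall i, continuous (f i)) ->
  continuous (fun z => \sum_(i <- s | P i) f i z).
Proof.
move=> cf; apply: continuous_big => [|i _]; last exact: cf.
exact: add_continuous.
Qed.

Lemma continuous_prod (I : Type) (s : seq I) (P : pred I) (f : I -> T -> R) :
  (forall i, continuous (f i)) ->
  continuous (fun z => \prod_(i <- s | P i) f i z).
Proof.
move=> cf; apply: continuous_big => [|i _]; last exact: cf.
exact: mul_continuous.
Qed.

Lemma mx_continuous_cst m n (M : 'M[R]_(m, n)) : mx_continuous (fun=> M).
Proof. by move=> i j z; exact: cvg_cst. Qed.

Lemma mx_continuousD m n (F G : T -> 'M[R]_(m, n)) :
  mx_continuous F -> mx_continuous G -> mx_continuous (fun z => F z + G z).
Proof.
move=> cF cG i j z; under eq_fun do rewrite mxE.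
by apply: cvgD; [exact: cF | exact: cG].
Qed.

Lemma mx_continuousZ m n a (F : T -> 'M[R]_(m, n)) :
  mx_continuous F -> mx_continuous (fun z => a *: F z).
Proof.
move=> cF i j z; under eq_fun do rewrite mxE.
by apply: cvgM; [exact: cvg_cst | exact: cF].
Qed.

Lemma mx_continuousN m n (F : T -> 'M[R]_(m, n)) :
  mx_continuous F -> mx_continuous (fun z => - F z).
Proof.
move=> cF; under eq_fun do rewrite -scaleN1r.
exact: mx_continuousZ.
Qed.

Lemma mx_continuousM m n p (F : T -> 'M[R]_(m, n)) (G : T -> 'M[R]_(n, p)) :
  mx_continuous F -> mx_continuous G -> mx_continuous (fun z => F z *m G z).
Proof.
move=> cF cG i j; under eq_fun do rewrite mxE.
apply: continuous_sum => k z.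
by apply: cvgM; [exact: cF | exact: cG].
Qed.

Lemma mx_continuous_dg n (F : T -> 'cV[R]_n) :
  mx_continuous F -> mx_continuous (fun z => dg (F z)).
Proof.
move=> cF i j z; under eq_fun do rewrite !mxE.
case: (i == j); first exact: cF.
exact: cvg_cst.
Qed.

Lemma mx_continuous_col m1 m2 n (F : T -> 'M[R]_(m1, n)) (G : T -> 'M[R]_(m2, n)) :
  mx_continuous F -> mx_continuous G -> mx_continuous (fun z => col_mx (F z) (G z)).
Proof.
move=> cF cG i j; case: (split_ordP i) => k ->.
  by under eq_fun do rewrite col_mxEu; exact: cF.
by under eq_fun do rewrite col_mxEd; exact: cG.
Qed.

Lemma mx_continuous_usub m1 m2 n (F : T -> 'M[R]_(m1 + m2, n)) :
  mx_continuous F -> mx_continuous (fun z => usubmx (F z)).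
Proof. by move=> cF i j; under eq_fun do rewrite mxE; exact: cF. Qed.

Lemma mx_continuous_dsub m1 m2 n (F : T -> 'M[R]_(m1 + m2, n)) :
  mx_continuous F -> mx_continuous (fun z => dsubmx (F z)).
Proof. by move=> cF i j; under eq_fun do rewrite mxE; exact: cF. Qed.

Lemma continuous_det n (F : T -> 'M[R]_n) :
  mx_continuous F -> continuous (fun z => \det (F z)).
Proof.
move=> cF; apply: continuous_sum => s z.
by apply: cvgM; [exact: cvg_cst | apply: continuous_prod => i; exact: cF].
Qed.

End EntrywiseContinuity.

(** * Positivity on the voltage stability region *)

Section Stability.
Variables (R : realType) (n : nat) (E : rel 'I_n.+1) (r x : 'cV[R]_n).

Lemma continuous_det_phi_u' :
  continuous (fun z : 'cV[R]_(udim n) * 'cV[R]_(xidim n) =>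
    \det (phi_u' E r x (pb_of z.1) (qb_of z.1) (l_of z.1) (v_of z.1 z.2))).
Proof.
have c1 : mx_continuous (fun z : 'cV[R]_(udim n) * 'cV[R]_(xidim n) => z.1).
  move=> i j z; apply: (@cvg_comp _ _ _ fst (fun M : 'cV[R]__ => M i j) _ (nbhs z.1)).
    exact: cvg_fst.
  exact: coord_continuous.
have c2 : mx_continuous (fun z : 'cV[R]_(udim n) * 'cV[R]_(xidim n) => z.2).
  move=> i j z; apply: (@cvg_comp _ _ _ snd (fun M : 'cV[R]__ => M i j) _ (nbhs z.2)).
    exact: cvg_snd.
  exact: coord_continuous.
have cpb : mx_continuous (fun z : 'cV[R]_(udim n) * 'cV[R]_(xidim n) => pb_of z.1).
  exact: mx_continuous_usub.
have cqb : mx_continuous (fun z : 'cV[R]_(udim n) * 'cV[R]_(xidim n) => qb_of z.1).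
  by apply/mx_continuous_usub/mx_continuous_dsub.
have cl : mx_continuous (fun z : 'cV[R]_(udim n) * 'cV[R]_(xidim n) => l_of z.1).
  by apply/mx_continuous_usub/mx_continuous_dsub/mx_continuous_dsub.
have cv : mx_continuous (fun z : 'cV[R]_(udim n) * 'cV[R]_(xidim n) => v_of z.1 z.2).
  apply: mx_continuous_col; first exact: mx_continuous_usub.
  by apply/mx_continuous_usub; do 3!apply/mx_continuous_dsub.
have cc := mx_continuous_cst.
apply: continuous_det; apply: mx_continuousD.
  do ![apply: mx_continuousD].
  - by apply/mx_continuous_dg/mx_continuousM.
  - by apply: mx_continuousZ; do ![apply: mx_continuousM => //]; apply: mx_continuous_dg.
  - by apply: mx_continuousZ; do ![apply: mx_continuousM => //]; apply: mx_continuous_dg.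
apply: mx_continuousN; do ![apply: mx_continuousM => //].
exact: mx_continuous_dg.
Qed.

(** Without power and current only [dg (Ao^T *m 1)] survives, and the column
    sums of [Ao] are 1 because each non-root node has exactly one parent. *)
Lemma phi_u'_flat : rooted_tree E ->
  phi_u' E r x 0 0 0 (const_mx 1) = 1%:M.
Proof.
move=> treeE; have [_ parent _] := treeE.
have dg0 : dg (0 : 'cV[R]_n) = 0 by rewrite /dg !linear0.
rewrite /phi_u' dg0 !mul0mx !scaler0 !addr0 oppr0 addr0.
suff -> : (Ao R E)^T *m const_mx 1 = const_mx 1 :> 'cV_n.
  by rewrite /dg trmx_const diag_const_mx.
apply/matrixP => e j; rewrite !mxE.
have [p [pE p_uniq]] := parent (child e) isT.
rewrite (bigD1 p) //= big1 => [|k k_neq]; rewrite !mxE mulr1.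
  by rewrite pE addr0.
by case: (boolP (E _ _)) => // /p_uniq pk; rewrite pk eqxx in k_neq.
Qed.

(** A nonpositive value would, by the intermediate value property on a
    connected set joining [(u, xi)] to the flat solution, give a zero. *)
Lemma det_phi_u'_gt0 (treeE : rooted_tree E)
    (u : 'cV[R]_(udim n)) (xi : 'cV[R]_(xidim n)) :
  voltage_stability_region E r x (u, xi) ->
  0 < \det (phi_u' E r x (pb_of u) (qb_of u) (l_of u) (v_of u xi)).
Proof.
case=> C [Cflat CN connC] Cu.
set f := fun z : 'cV[R]_(udim n) * 'cV[R]_(xidim n) =>
    \det (phi_u' E r x (pb_of z.1) (qb_of z.1) (l_of z.1) (v_of z.1 z.2)).
have itvf : is_interval (f @` C).
  apply/connected_intervalP/connected_continuous_connected => //.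
  by apply: continuous_subspaceT => z; exact: continuous_det_phi_u'.
have f1 : f (flat_solution R n) = 1.
  rewrite /f /flat_solution /= /pb_of /qb_of /l_of /v_of /mk_u /mk_xi.
  by rewrite !(col_mxKu, col_mxKd) col_mx_const phi_u'_flat // det1.
rewrite -[X in 0 < X]/(f (u, xi)) ltNge; apply/negP => f_le0.
have [[u0 xi0] /CN[_ _ _ _ + f0]] : (f @` C) 0.
  apply: (itvf (f (u, xi)) 1); [by exists (u, xi)| |by rewrite f_le0 ler01].
  by exists (flat_solution R n).
by rewrite det_phi_u // -/(f (u0, xi0)) f0 eqxx.
Qed.

End Stability.

Theorem theorem1 (R : realType) (n : nat) (n_ge1 : (1 <= n)%N)
    (E : rel 'I_n.+1) (E_tree : rooted_tree E) (r x : 'cV[R]_n) :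
  [/\ (* (i) *)
      forall (pb qb l : 'cV[R]_n) (v : 'cV[R]_(1 + n)),
        \det (phi_u E r x pb qb l v) = \det (phi_u' E r x pb qb l v),
      (* (ii) *)
      forall (u : 'cV[R]_(udim n)) (xi : 'cV[R]_(xidim n)),
        voltage_stability_region E r x (u, xi) ->
        0 < \det (phi_u' E r x (pb_of u) (qb_of u) (l_of u) (v_of u xi))
    & (* (iii) *)
      forall (pb qb l : 'cV[R]_n) (v : 'cV[R]_(1 + n)),
        \det (phi_u' E r x pb qb l v) = 0 <->
        exists i : 'I_n.+1,
          E ord0 i /\ \det (phi_u'_at E i r x pb qb l v) = 0].
Proof.
split=> [pb qb l v|u xi|pb qb l v].
- exact: det_phi_u.
- exact: det_phi_u'_gt0.
- exact: det_phi_u'_eq0.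
Qed.
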